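(* Let $B$ be a bicyclic graph on $n$ vertices. Then ${\rm pind}(A_{B})=1$. Hence $B$ is $(2,2)$-choosable.
   Context: Graphs are finite and simple. A bicyclic graph is a connected graph with $n$ vertices and $n+1$ edges for some $n$ (such a graph contains two or three cycles). The permanent of an $m\times m$ real matrix $A=[a_{ij}]$ is ${\rm per}(A)=\sum_{\sigma}\prod_{i=1}^{m}a_{i\sigma(i)}$, summed over all permutations $\sigma$ of $\{1,\ldots,m\}$. The permanent index ${\rm pind}(A)$ of a matrix $A$ with $m$ rows is the minimum integer $k$ such that there is an $m\times m$ matrix $A'$ with ${\rm per}(A')\neq 0$, each column of which is a column of $A$, and such that each column of $A$ occurs in $A'$ at most $k$ times. For a graph $G$, fix an orientation of its edges. $A_G$ is the matrix with rows indexed by the edges of $G$ and columns indexed by the vertices and edges of $G$, where for $e=(u,v)$ (oriented from $u$ to $v$), $A_G[e,y]=1$ if $y=v$ or $y\neq e$ is an edge incident to $v$; $A_G[e,y]=-1$ if $y=u$ or $y\neq e$ is an edge incident to $u$; and $A_G[e,y]=0$ otherwise. (Reversing an edge multiplies the corresponding row by $-1$, so ${\rm pind}(A_G)$ does not depend on the orientation.) A total-weighting of $G=(V,E)$ is a mapping $f:V\cup E\to\mathbb{R}$. For $v\in V$ put $s(v)=f(v)+\sum_{e\in E(v)}f(e)$, where $E(v)$ is the set of edges incident with $v$. The total-weighting $f$ is proper if $s(u)\neq s(v)$ for any two adjacent vertices $u,v$. The graph $G$ is $(k,k')$-choosable if for every assignment $L$ of a set $L(v)$ of $k$ real numbers to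 each vertex $v$ and a set $L(e)$ of $k'$ real numbers to each edge $e$, there is a proper total-weighting $f$ with $f(z)\in L(z)$ for all $z\in V\cup E$. *)

(* Defs.v *)
From HB Require Import structures.
From mathcomp Require Import all_boot all_order all_algebra all_fingroup finmap.
From mathcomp Require Import reals.

Set Implicit Arguments.
Unset Strict Implicit.
Unset Printing Implicit Defensive.

Import Order.TTheory GRing.Theory Num.Theory.
Local Open Scope ring_scope.

Record sgraph := SGraph {
  vertex :> finType;
  adj : rel vertex;
  adj_sym : symmetric adj;
  adj_irrefl : irreflexive adj
}.

Definition edge_set (G : sgraph) : {set {set G}} :=
  [set e : {set G} | [exists u, exists v, adj u v && (e == [set u; v])]].

(* An edge is a two-element set of vertices; [v \in val e] is incidence. *)
Definition edge (G : sgraph) : finType := {e : {set G} | e \in edge_set G}.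

Definition connected_graph (G : sgraph) : Prop :=
  forall u v : G, connect (@adj G) u v.

(* The edge count already excludes the graph without vertices. *)
Definition bicyclic (G : sgraph) : Prop :=
  connected_graph G /\ #|edge G| = #|G|.+1.

Record orientation (G : sgraph) := Orientation {
  tail : edge G -> G;
  head : edge G -> G;
  orientationP : forall e : edge G, val e = [set tail e; head e]
}.

Definition permanent (R : realType) (m : nat) (A : 'M[R]_m) : R :=
  \sum_(s : 'S_m) \prod_(i < m) A i (s i).

(* [colsub g A] is the square matrix whose [j]-th column is column [g j] of
   [A]; multiplicities count column positions of [A]. *)
Definition pind_le (R : realType) (m p : nat) (A : 'M[R]_(m, p)) (k : nat) :
    Prop :=
  exists g : 'I_m -> 'I_p,
    permanent (colsub g A) != 0 /\
    forall j : 'I_p, (#|[set i | g i == j]| <= k)%N.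

(* [is_pind A k] says that [k] is the permanent index of [A]. It is a relation
   because no [k] is feasible when every such square matrix has permanent 0. *)
Definition is_pind (R : realType) (m p : nat) (A : 'M[R]_(m, p)) (k : nat) :
    Prop :=
  pind_le A k /\ forall k' : nat, pind_le A k' -> (k <= k')%N.

Definition AG_entry (R : realType) (G : sgraph) (o : orientation G)
    (e : edge G) (y : G + edge G) : R :=
  match y with
  | inl v => if v == head o e then 1 else if v == tail o e then -1 else 0
  | inr e' =>
      if e' == e then 0
      else if head o e \in val e' then 1
      else if tail o e \in val e' then -1
      else 0
  end.

Definition AG (R : realType) (G : sgraph) (o : orientation G) :
    'M[R]_(#|edge G|, #|{: G + edge G}|) :=
  \matrix_(i, j) AG_entry R o (enum_val i) (enum_val j).

Definition weight_sum (R : realType) (G : sgraph) (f : G + edge G -> R)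
    (v : G) : R :=
  f (inl v) + \sum_(e : edge G | v \in val e) f (inr e).

Definition proper_weighting (R : realType) (G : sgraph)
    (f : G + edge G -> R) : Prop :=
  forall u v : G, adj u v -> weight_sum f u <> weight_sum f v.

Definition choosable (R : realType) (G : sgraph) (k k' : nat) : Prop :=
  forall L : G + edge G -> {fset R},
    (forall v : G, #|` L (inl v)| = k) ->
    (forall e : edge G, #|` L (inr e)| = k') ->
    exists f : G + edge G -> R,
      proper_weighting f /\ forall z : G + edge G, f z \in L z.

(* Main.v *)
Require Import Defs.
From mathcomp Require Import all_boot all_order all_algebra all_fingroup finmap.
From mathcomp Require Import reals zify ring.
Import Defs.

(** Write Y for the vertices and edges together and A_y for the column of A_G
    at y. An edge uv satisfies A_uv = A_u + A_v, and the vertex columns form the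
    signed incidence matrix, so the permanent of a family of vertex columns
    [om : edges -> vertices] is the number of permutations of the edges that
    preserve [om] times a signed count of the assignments of an endpoint to each
    edge in which every vertex is chosen as often as by [om].

    Permanents are multilinear in the columns. Hence, if column j is
    a combination of two columns of A, taken from pairs disjoint for distinct j,
    and the permanent is nonzero, then picking suitable members of the pairs
    gives distinct columns of A with nonzero permanent ([fperm_span],
    [span_injection]). In particular let [phi] assign distinct endpoints to the
    edges of some set. Then A_e and A_(phi e) span the columns of both endpoints
    of e, so for these edges any choice of endpoint columns is available.
    With one more edge than vertices, [phi] cannot cover all edges; it can leave
    out two edges e1 = ab and e2 = ac and avoid their common vertex a. For the
    slots of e1 and e2 the distinct columns A_e1, A_e2 and A_a remain, and

      (a+b)(a+c) - (a+b)a - a(a+c) = bc - aa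

    shows that one of the three pairs works as soon as the choices bc and aa
    give different permanents ([fperm_two_columns]).

    The other edges receive their larger endpoint in a linear order. Then the
    assignment is the only one with its multiplicities, in the case bc with a as
    the least vertex, and in the case aa with a raised above b and c. So both
    permanents are a common nonzero product times the number of permutations of
    the edges that preserve the assignment ([fperm_top]). If b and c are not
    adjacent, they come next after a in the order, and no other edge chooses
    them; the numbers have ratio 1 to 2. If b and c are adjacent, one of them, say
    c, has another neighbour d in the set C introduced below. Place c above and b
    below the other vertices of C.
    Compared with the permutations that fix e1 and e2, adding e2 to the class of
    c, which has at least the two edges bc and cd, multiplies the number by at
    least 3, while the class of e1 and e2 at a multiplies it by 2 only.

    The vertices a, b, c lie in a minimal set C that spans more edges than it has
    vertices: in C every degree is at least 2 and some vertex a has degree 2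
    ([core_degree2]). Sparsity of the smaller sets gives Hall's condition for
    [phi] and the neighbour d ([bicyclic_pivot]). Vertices outside C are placed
    above C in the order, so that a stays the smaller end of its edges leaving C.

    Finally, let [h] pick distinct columns with nonzero permanent, one per edge,
    and let only the weights at these columns vary, each over its two values.
    The alternating sum of the products over the edges uv of s(v) - s(u) is the
    permanent times the product of the differences of the two values
    ([fperm_alternating_sum]), so one of the weightings is proper. *)

Set Implicit Arguments.
Unset Strict Implicit.
Unset Printing Implicit Defensive.

Import Order.TTheory GRing.Theory Num.Theory.

(** * Hall's marriage theorem *)

(** Rado's argument: if some N i contains x and y, one of them can be deleted
    from N i without violating Hall's condition. Otherwise there are violators
    F1 and F2, both containing i; by submodularity their union or their
    intersection without i would violate the condition for N itself. *)
Lemma hall_marriage (I T : finType) (P : {set I}) (N : I -> {set T}) (x0 : T) :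
  (forall F : {set I}, F \subset P -> #|F| <= #|\bigcup_(i in F) N i|) ->
  exists2 phi : I -> T, {in P, forall i, phi i \in N i} & {in P &, injective phi}.
Proof.
(* Induction on the total size: when all N i are singletons, phi is forced. *)
have [k] := ubnP (\sum_(i in P) #|N i|).
elim: k => // k IH in N *; rewrite ltnS => leNk hallN.
case: (boolP [exists i in P, 1 < #|N i|]) => [/exists_inP[i Pi]|]; last first.
  move/exists_inPn=> N_le1; pose phi i := odflt x0 [pick x in N i].
  have N1 i : i \in P -> N i = [set phi i].
    move=> Pi; have := hallN [set i]; rewrite sub1set Pi big_set1 cards1 => /(_ isT).
    have := N_le1 i Pi; rewrite -leqNgt => le1 ge1.
    have /cards1P[x Nx] : #|N i| == 1 by rewrite eqn_leq le1.
    rewrite /phi; case: pickP => [y|/(_ x)]; rewrite Nx !inE ?eqxx //.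
    by move=> /eqP->.
  exists phi => [i /N1->|i j Pi Pj eq_phi]; first by rewrite inE.
  apply/eqP; apply: contraT => neq_ij.
  have := hallN [set i; j]; rewrite subUset !sub1set Pi Pj => /(_ isT).
  by rewrite bigcup_setU !big_set1 !N1 // eq_phi setUid cards1 cards2 neq_ij.
case/card_gt1P=> x [y [Nx Ny neq_xy]].
pose del z j := if j == i then N i :\ z else N j.
have del_lt z : z \in N i -> \sum_(j in P) #|del z j| < k.
  move=> Nz; apply: leq_trans leNk; rewrite (bigD1 i) // [ltnRHS](bigD1 i) //=.
  rewrite /del eqxx [#|N i|](cardsD1 z) Nz addSn ltnS leq_add2l.
  by apply: leq_sum => j /andP[_ /negPf->].
have del_sub z j : del z j \subset N j.
  by rewrite /del; case: eqP => [->|_]; rewrite ?subD1set.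
have extend z : z \in N i ->
    (forall F : {set I}, F \subset P -> #|F| <= #|\bigcup_(j in F) del z j|) ->
    exists2 phi : I -> T, {in P, forall i, phi i \in N i} & {in P &, injective phi}.
  move=> Nz hall; have [phi Nphi inj] := IH _ (del_lt z Nz) hall.
  by exists phi => // j /Nphi; apply/subsetP.
pose bad z (F : {set I}) :=
  [&& F \subset P & #|\bigcup_(j in F) del z j| < #|F|].
have [F1 bad1|ok] := pickP (bad x); last first.
  by apply: (extend x) => // F FP; have := ok F; rewrite /bad FP /= ltnNge => /negbFE.
have [F2 bad2|ok] := pickP (bad y); last first.
  by apply: (extend y) => // F FP; have := ok F; rewrite /bad FP /= ltnNge => /negbFE.
have memF z F : bad z F -> i \in F.
  case/andP=> FP; rewrite ltnNge; apply: contraR => notFi.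
  apply: leq_trans (hallN F FP) _; rewrite eq_leq //; congr #|pred_of_set _|.
  by apply: eq_bigr => j Fj; rewrite /del; case: eqP Fj notFi => // -> ->.
have [F1i F2i] := (memF x F1 bad1, memF y F2 bad2).
case/andP: bad1 => F1P lt1; case/andP: bad2 => F2P lt2.
set U1 := \bigcup_(j in F1) _ in lt1; set U2 := \bigcup_(j in F2) _ in lt2.
have subU : \bigcup_(j in F1 :|: F2) N j \subset U1 :|: U2.
  apply/subsetP=> z /bigcupP[j Fj Njz]; case: (eqVneq j i) Fj Njz => [-> _|ne].
    case: (eqVneq z x) => [->|zx] Niz; apply/setUP; [right|left].
      by apply/bigcupP; exists i; rewrite // /del eqxx !inE neq_xy.
    by apply/bigcupP; exists i; rewrite // /del eqxx !inE zx.
  case/setUP=> Fj Njz; apply/setUP; [left|right];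
    by apply/bigcupP; exists j; rewrite // /del (negPf ne).
have subI : \bigcup_(j in (F1 :&: F2) :\ i) N j \subset U1 :&: U2.
  apply/bigcupsP=> j /setD1P[ne /setIP[F1j F2j]]; rewrite subsetI.
  by apply/andP; split; [have := bigcup_sup j F1j (F := del x)
    | have := bigcup_sup j F2j (F := del y)]; rewrite {1}/del (negPf ne).
have FUP : F1 :|: F2 \subset P by rewrite subUset F1P.
have FIP : (F1 :&: F2) :\ i \subset P.
  by rewrite subDset (subset_trans (subsetIl _ _)) // subsetU ?F1P ?orbT.
have := leq_trans (hallN _ FUP) (subset_leq_card subU).
have := leq_trans (hallN _ FIP) (subset_leq_card subI).
have := cardsUI U1 U2; have := cardsUI F1 F2.
have := cardsD1 i (F1 :&: F2); rewrite inE F1i F2i /=.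
by move: lt1 lt2; clearbody U1 U2; clear; lia.
Qed.

(** * Spanned edges and the core of a bicyclic graph *)

Lemma edge_endsP (G : sgraph) (e : edge G) :
  exists u v : G, [/\ adj u v, u != v & val e = [set u; v]].
Proof.
have := valP e; rewrite inE => /existsP[u /existsP[v /andP[uv /eqP->]]].
exists u, v; split=> //; apply/eqP=> eq_uv.
by move: uv; rewrite eq_uv adj_irrefl.
Qed.

Lemma adj_edge (G : sgraph) (u v : G) :
  adj u v -> exists e : edge G, val e = [set u; v].
Proof.
move=> uv; have e_uv : [set u; v] \in edge_set G.
  by rewrite inE; apply/existsP; exists u; apply/existsP; exists v; rewrite uv /=.
by exists (Sub [set u; v] e_uv); rewrite SubK.
Qed.

Lemma card_edge (G : sgraph) (e : edge G) : #|val e| = 2.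
Proof. by have [u [v [_ ne ->]]] := edge_endsP e; rewrite cards2 ne. Qed.

Lemma edge_other_end (G : sgraph) (e : edge G) (a : G) :
  a \in val e -> exists2 b, b != a & val e = [set a; b].
Proof.
have [u [v [_ ne ->]]] := edge_endsP e; rewrite !inE => /orP[]/eqP->.
  by exists v; rewrite 1?eq_sym.
by exists u => //; rewrite setUC.
Qed.

Definition inner_edges (G : sgraph) (X : {set G}) : {set edge G} :=
  [set e : edge G | val e \subset X].

Definition inner_star (G : sgraph) (X : {set G}) (v : G) : {set edge G} :=
  [set e in inner_edges X | v \in val e].

Lemma inner_edgesS (G : sgraph) (X Y : {set G}) :
  X \subset Y -> inner_edges X \subset inner_edges Y.
Proof.
by move=> XY; apply/subsetP=> e; rewrite !inE => /subset_trans; apply.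
Qed.

Lemma inner_edgesI (G : sgraph) (X Y : {set G}) :
  inner_edges (X :&: Y) = inner_edges X :&: inner_edges Y.
Proof. by apply/setP=> e; rewrite !inE subsetI. Qed.

Lemma inner_edgesD1 (G : sgraph) (X : {set G}) (v : G) :
  inner_edges (X :\ v) = inner_edges X :\: inner_star X v.
Proof.
by apply/setP=> e; rewrite !inE subsetD1; case: (_ \subset _); case: (_ \in _).
Qed.

Lemma card_inner_edgesD1 (G : sgraph) (X : {set G}) (v : G) :
  #|inner_edges X| = #|inner_edges (X :\ v)| + #|inner_star X v|.
Proof.
have sub : inner_star X v \subset inner_edges X.
  by apply/subsetP=> e; rewrite inE => /andP[].
by rewrite inner_edgesD1 -(cardsID (inner_star X v)) (setIidPr sub) addnC.
Qed.

Lemma sum_inner_star (G : sgraph) (X : {set G}) :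
  \sum_(v in X) #|inner_star X v| = 2 * #|inner_edges X|.
Proof.
under eq_bigr => v _ do rewrite -sum1_card.
rewrite (exchange_big_dep (mem (inner_edges X))) /=; last first.
  by move=> v e _; rewrite inE => /andP[].
rewrite mulnC -sum_nat_const; apply: eq_bigr => e Xe.
rewrite sum1_card -(card_edge e); apply: eq_card => v.
rewrite inE in Xe; rewrite unfold_in /= !inE Xe /=.
by case: (boolP (v \in val e)) => [/(subsetP Xe)->|_]; rewrite ?andbF.
Qed.

(** Adding to X the vertices outside X one at a time, each along an edge that
    leaves the set reached so far, gains an edge at every step. *)
Lemma connected_edge_growth (G : sgraph) (X : {set G}) :
  connected_graph G -> X != set0 -> #|inner_edges X| + #|~: X| <= #|edge G|.
Proof.
move=> connG; have [k] := ubnP #|~: X|; elim: k => // k IH in X *.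
rewrite ltnS => leXk /set0Pn[x Xx].
have [/existsP[u /existsP[v /and3P[Xu Xv uv]]]|noexit] :=
  boolP [exists u, exists v, [&& u \in X, v \notin X & adj u v]].
  have XCD : #|~: X| = #|~: (v |: X)|.+1.
    by rewrite (cardsD1 v) inE Xv setCU setIC -setDE.
  have ne0 : v |: X != set0 by apply/set0Pn; exists v; rewrite setU11.
  have := IH (v |: X); rewrite -XCD => /(_ leXk ne0); rewrite XCD addnS.
  apply: leq_trans; rewrite -addSn leq_add2r; apply: proper_card.
  rewrite properE inner_edgesS ?subsetUr //=; have [e val_e] := adj_edge uv.
  apply/subsetPn; exists e; rewrite !inE val_e subUset !sub1set ?Xu ?(negPf Xv) //.
  by rewrite !inE Xu eqxx orbT.
have XT : X = setT.
  apply/setP=> y; rewrite [RHS]inE -(closed_connect _ (connG x y)) //.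
  apply: intro_closed => [|u v uv Xu]; first exact/sym_connect_sym/adj_sym.
  by apply: contraR noexit => Xv; apply/existsP; exists u; apply/existsP; exists v;
     rewrite Xu Xv uv.
by rewrite XT setCT cards0 addn0 max_card.
Qed.

Lemma bicyclic_edge_bound (G : sgraph) (X : {set G}) :
  bicyclic G -> #|inner_edges X| <= #|X|.+1.
Proof.
move=> [connG eG]; case: (eqVneq X set0) => [->|ne].
  rewrite (_ : inner_edges _ = set0) ?cards0 //; apply/setP=> e; rewrite !inE subset0.
  by rewrite -cards_eq0 card_edge.
by have := connected_edge_growth connG ne; have := cardsC X; rewrite eG; lia.
Qed.

Definition core (G : sgraph) (C : {set G}) : Prop :=
  #|inner_edges C| = #|C|.+1 /\
  forall X : {set G}, X \proper C -> #|inner_edges X| <= #|X|.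

(** Minimal among the sets that span more edges than they have vertices. In graph
    terms this is the theta graph, or the two cycles with the path joining them,
    that remains when pendant trees are pruned. *)
Lemma bicyclic_core (G : sgraph) : bicyclic G -> exists C : {set G}, core C.
Proof.
move=> bG; pose dense (X : {set G}) := #|X| < #|inner_edges X|.
have denseT : dense [set: G].
  rewrite /dense cardsT; case: bG => _ eG.
  rewrite (_ : inner_edges _ = setT) ?cardsT ?eG //.
  by apply/setP=> e; rewrite !inE subsetT.
have [C /minsetP[dC minC] _] := minset_exists denseT.
exists C; split; first by apply/eqP; rewrite eqn_leq bicyclic_edge_bound.
move=> X /andP[XC nCX]; rewrite leqNgt; apply/negP=> dX.
by rewrite (minC X dX XC) subxx in nCX.
Qed.

(** Deleting a vertex of degree at most 1 would leave a smaller set that still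
    spans more edges than it has vertices. *)
Lemma core_min_degree (G : sgraph) (C : {set G}) : core C ->
  {in C, forall v, 2 <= #|inner_star C v|}.
Proof.
move=> [eC sparse] v Cv; have := sparse _ (properD1 Cv).
by have := card_inner_edgesD1 C v; rewrite eC (cardsD1 v C) Cv; lia.
Qed.

Lemma card_inner_edges_le (G : sgraph) (X : {set G}) :
  #|inner_edges X| <= 'C(#|X|, 2).
Proof.
rewrite -cards_draws -(card_imset (mem (inner_edges X)) val_inj).
apply: subset_leq_card; apply/subsetP=> _ /imsetP[e Xe ->].
by rewrite !inE card_edge eqxx andbT; move: Xe; rewrite inE.
Qed.

(** The degrees in C are at least 2 and add up to 2|C| + 2, so if none equals 2
    then |C| is at most 2, too small to span |C| + 1 edges. *)
Lemma core_degree2 (G : sgraph) (C : {set G}) : core C ->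
  exists2 a, a \in C & #|inner_star C a| = 2.
Proof.
move=> coreC; have [eC _] := coreC.
have [/exists_inP[a Ca /eqP deg_a]|no2] :=
  boolP [exists a in C, #|inner_star C a| == 2]; first by exists a.
have ge3 : {in C, forall v, 3 <= #|inner_star C v|}.
  move=> v Cv; move/exists_inPn/(_ v Cv): no2 => ne2.
  by rewrite ltn_neqAle eq_sym ne2 core_min_degree.
have : #|C| * 3 <= 2 * #|C|.+1.
  by rewrite -sum_nat_const -eC -sum_inner_star leq_sum.
have := card_inner_edges_le C; rewrite eC.
case: #|C| => [|[|[|n]]]; rewrite ?bin0n ?binn //; lia.
Qed.

(** The configuration that drives the permanent computation. All edges at a other
    than e1 and e2 leave C, so their larger endpoint is not affected by the place
    of a in the order of C. If b and c are adjacent, the edges bc and cd make the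
    class of c large enough to be told apart from the class of a. *)
Record pivot (G : sgraph) (C : {set G}) (a b c : G) (e1 e2 : edge G)
    (phi : edge G -> G) : Prop := Pivot {
  pivot_e1 : val e1 = [set a; b];
  pivot_e2 : val e2 = [set a; c];
  pivot_ab : a != b;
  pivot_ac : a != c;
  pivot_bc : b != c;
  pivot_a_in : a \in C;
  pivot_b_in : b \in C;
  pivot_c_in : c \in C;
  pivot_star : forall e : edge G, a \in val e -> val e \subset C ->
    (e == e1) || (e == e2);
  pivot_phi_end : {in ~: [set e1; e2], forall e, phi e \in val e :\ a};
  pivot_phi_inj : {in ~: [set e1; e2] &, injective phi};
  pivot_triangle : forall e3 : edge G, val e3 = [set b; c] ->
    exists (d : G) (e4 : edge G),
      [/\ d \in C, d \notin [set a; b; c] & val e4 = [set c; d]]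
}.

(** The two edges at a vertex a of degree 2 in a core C serve as ab and ac. Hall's
    condition follows from [rest_bound], which combines submodularity of the
    number of spanned edges, the bound |X| + 1 for C and X together, and sparsity
    of the part of C that X contains, without a. *)
Lemma bicyclic_pivot (G : sgraph) : bicyclic G ->
  exists C a b c e1 e2 phi, @pivot G C a b c e1 e2 phi.
Proof.
move=> bG; have [C coreC] := bicyclic_core bG.
have [eC sparse] := coreC.
have [a Ca /eqP/cards2P[e1 [e2 [ne12 star_a]]]] := core_degree2 coreC.
have star (e : edge G) : a \in val e -> val e \subset C -> (e == e1) || (e == e2).
  by move=> ea eC'; have := in_set2 e e1 e2; rewrite -star_a !inE ea eC'.
have [/andP[Ce1 ae1] /andP[Ce2 ae2]] : (val e1 \subset C) && (a \in val e1) /\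
    (val e2 \subset C) && (a \in val e2).
  by have := set21 e1 e2; have := set22 e1 e2; rewrite -star_a !inE.
have [b ne_ba val_e1] := edge_other_end ae1.
have [c ne_ca val_e2] := edge_other_end ae2.
have ne_bc : b != c.
  by apply: contraNneq ne12 => eq_bc; apply/eqP/val_inj; rewrite val_e1 val_e2 eq_bc.
have [Cb Cc] : b \in C /\ c \in C.
  move: Ce1 Ce2; rewrite val_e1 val_e2 !subUset !sub1set.
  by move=> /andP[_ ->] /andP[_ ->].
pose rest X := inner_edges X :\: [set e1; e2].
have rest_bound (X : {set G}) : a \in X -> #|rest X| < #|X|.
  move=> aX.
  have cardI : #|inner_edges (X :&: C)| = #|inner_edges ((X :&: C) :\ a)| +
      #|inner_edges (X :&: C) :&: [set e1; e2]|.
    rewrite (card_inner_edgesD1 _ a); congr (_ + _); apply: eq_card => e.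
    by rewrite -star_a !inE subsetI; case: (_ \subset _); case: (_ \subset _).
  have sparseI : #|inner_edges ((X :&: C) :\ a)| < #|X :&: C|.
    rewrite [ltnRHS](cardsD1 a) inE aX Ca ltnS; apply: sparse.
    by apply: sub_proper_trans (properD1 Ca); rewrite setSD ?subsetIr.
  have eU : #|inner_edges X| + #|C|.+1 <= #|X :|: C|.+1 + #|inner_edges (X :&: C)|.
    rewrite -eC -cardsUI -inner_edgesI leq_add2r.
    apply: leq_trans (bicyclic_edge_bound (X :|: C) bG); apply: subset_leq_card.
    by rewrite subUset !inner_edgesS ?subsetUl ?subsetUr.
  have := cardsID [set e1; e2] (inner_edges X); rewrite -/(rest X).
  have -> : inner_edges X :&: [set e1; e2] = inner_edges (X :&: C) :&: [set e1; e2].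
    apply/setP=> e; rewrite -star_a !inE subsetI.
    by case: (_ \subset _); case: (_ \subset _).
  by move: cardI sparseI eU (cardsUI X C); clear; lia.
have [F FP|phi phi_end phi_inj] := @hall_marriage _ _ (~: [set e1; e2])
    (fun e : edge G => val e :\ a) a.
  rewrite -ltnS.
  pose X := a |: \bigcup_(e in F) (val e :\ a).
  have <- : #|X| = #|\bigcup_(e in F) (val e :\ a)|.+1.
    by rewrite cardsU1; case: bigcupP => [[e _]|_]; rewrite ?add1n // !inE eqxx.
  apply: leq_ltn_trans (rest_bound X (setU11 _ _)); apply: subset_leq_card.
  apply/subsetP=> e Fe; have e12 := subsetP FP e Fe.
  rewrite in_setC in e12; apply/setDP; split; rewrite // in_set.
  apply/subsetP=> v ev; rewrite !inE; case: eqVneq => //= ne_va.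
  by apply/bigcupP; exists e; rewrite // !inE ne_va.
(* If no edge of C joined b or c to the rest of C, removing a, b, c would lose at
   most three edges, so the rest would span too many. The roles of b and c are
   exchanged when d is a neighbour of b. *)
have [d [e4 [Cd d_new ve4]]] : exists (d : G) (e4 : edge G),
    [/\ d \in C, d \notin [set a; b; c]
      & val e4 = [set b; d] \/ val e4 = [set c; d]].
  pose link d (e : edge G) := (d \in C) && (d \notin [set a; b; c]) &&
    ((val e == [set b; d]) || (val e == [set c; d])).
  have [/existsP[d /existsP[e4 /andP[/andP[? ?] /orP[]/eqP?]]]|nolink] :=
    boolP [exists d : G, exists e4 : edge G, link d e4].
  - by exists d, e4; split=> //; left.
  - by exists d, e4; split=> //; right.
  have no d (e : edge G) : d \in C -> d \notin [set a; b; c] ->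
      val e <> [set b; d] /\ val e <> [set c; d].
    move=> Cd dN; move/existsPn/(_ d)/existsPn/(_ e): nolink.
    by rewrite /link Cd dN /= negb_or => /andP[/eqP? /eqP].
  pose S3 := [set e : edge G | val e == [set b; c]].
  have S3_le1 : #|S3| <= 1.
    apply/card_le1_eqP=> e e'; rewrite !inE => /eqP ve /eqP ve'.
    by apply/val_inj; rewrite ve ve'.
  have other v (e : edge G) : v \in [set b; c] -> v \in val e -> a \notin val e ->
      val e \subset C -> e \in S3.
    rewrite !inE => /orP[]/eqP-> /edge_other_end[x xv ve]; rewrite ve !inE negb_or =>
      /andP[av ax]; rewrite subUset !sub1set => /andP[_ Cx].
      have := no x e Cx; rewrite !inE (eq_sym x a) (negPf ax) (negPf xv) /=.
      by case: (eqVneq x c) => [->//|_ /(_ isT)[]].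
    have := no x e Cx; rewrite !inE (eq_sym x a) (negPf ax) (negPf xv) orbF /=.
    by case: (eqVneq x b) => [->|_ /(_ isT)[] //]; rewrite setUC.
  have cover : inner_edges C \subset
      inner_edges (C :\: [set a; b; c]) :|: ([set e1; e2] :|: S3).
    apply/subsetP=> e; rewrite inE => eCC; rewrite in_setU in_setU.
    case: (boolP (a \in val e)) => [ea|ea]; first by rewrite in_set2 star ?orbT.
    case: (boolP (b \in val e)) => [eb|eb].
      by rewrite (other b e) ?orbT // set21.
    case: (boolP (c \in val e)) => [ec|ec].
      by rewrite (other c e) ?orbT // set22.
    apply/orP; left; rewrite inE subsetD eCC disjoint_sym /=.
    apply/pred0P=> v /=; rewrite !inE -!orbA.
    by apply/negP=> /andP[/or3P[]/eqP->]; apply/negP.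
  have T3 : [set a; b; c] \subset C by rewrite !subUset !sub1set Ca Cb Cc.
  have card3 : #|[set a; b; c]| = 3.
    by rewrite setUC cardsU1 cards2 !inE negb_or ne_ca (eq_sym a) ne_ba eq_sym ne_bc.
  exfalso; have := S3_le1; have := subset_leq_card cover; rewrite eC.
  have := sparse (C :\: [set a; b; c]); rewrite properE subDset subsetUr /=.
  have -> : ~~ (C \subset C :\: [set a; b; c]).
    by apply/subsetPn; exists a; rewrite // !inE eqxx.
  move=> /(_ isT); rewrite cardsD (setIidPr T3) card3.
  have := subset_leq_card T3; rewrite card3.
  have := cards2 e1 e2; rewrite ne12 /=.
  have := (leq_card_setU (inner_edges (C :\: [set a; b; c])) ([set e1; e2] :|: S3)).1.
  have := (leq_card_setU [set e1; e2] S3).1.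
  move: #|S3| #|[set e1; e2]| #|[set e1; e2] :|: S3| #|inner_edges _|.
  move: #|inner_edges _ :|: _| #|C|.
  by clear; lia.
have [ne_ab ne_ac] : a != b /\ a != c by rewrite !(eq_sym a).
case: ve4 => ve4; [exists C, a, c, b, e2, e1, phi|exists C, a, b, c, e1, e2, phi].
  have ne_cb : c != b by rewrite eq_sym.
  apply: (Pivot val_e2 val_e1 ne_ac ne_ab ne_cb Ca Cc Cb) => [e ea eCC|||e3 _].
  - by rewrite orbC star.
  - by rewrite setUC.
  - by rewrite setUC.
  - exists d, e4; split=> //; apply: contra d_new; rewrite !inE -!orbA.
    by case/or3P=> ->; rewrite ?orbT.
apply: (Pivot val_e1 val_e2 ne_ab ne_ac ne_bc Ca Cb Cc star phi_end phi_inj).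
by move=> e3 _; exists d, e4.
Qed.

(** * Permanents over a finite index type *)

Local Open Scope ring_scope.

(** The permanent, indexed by the edges themselves: the row of an edge and the
    slot whose column replaces it can then be compared without a numbering. *)
Definition fperm (R : realType) (I : finType) (X : I -> I -> R) : R :=
  \sum_(s : {perm I}) \prod_i X i (s i).

Lemma fperm_col (R : realType) (I : finType) (X : I -> I -> R) :
  fperm X = \sum_(s : {perm I}) \prod_j X (s j) j.
Proof.
rewrite /fperm (reindex_inj invg_inj) /=; apply: eq_bigr => s _.
rewrite (reindex_perm s) /=; apply: eq_bigr => i _; by rewrite permK.
Qed.

Lemma eq_fperm (R : realType) (I : finType) (X Y : I -> I -> R) :
  X =2 Y -> fperm X = fperm Y.
Proof. by move=> XY; apply: eq_bigr => s _; apply: eq_bigr => i _. Qed.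

(** Multilinear expansion: some term of the expansion is nonzero. *)
Lemma fperm_span (R : realType) (I Y : finType) (A c : I -> Y -> R) :
  fperm (fun i j => \sum_y c j y * A i y) != 0 ->
  exists h : I -> Y, (forall j, c j (h j) != 0) /\
    fperm (fun i j => A i (h j)) != 0.
Proof.
move=> nz.
have [/existsP[h /andP[/forallP ch Ah]]|no] := boolP [exists h : {ffun I -> Y},
  [forall j, c j (h j) != 0] && (fperm (fun i j => A i (h j)) != 0)].
  by exists h.
case/eqP: nz; rewrite fperm_col.
under eq_bigr => s _ do rewrite bigA_distr_bigA /=.
rewrite exchange_big /= big1 // => h _.
under eq_bigr => s _ do rewrite big_split /=.
rewrite -big_distrr /= -(fperm_col (fun i j => A i (h j))); apply/eqP.
move/existsPn/(_ h): no; rewrite negb_and mulf_eq0 => /orP[/forallPn[j]|/negbNE->].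
  by rewrite negbK (bigD1 j) //= => /eqP->; rewrite mul0r eqxx.
by rewrite orbT.
Qed.

Lemma prod_two_factors (R : realType) (I : finType) (F : I -> R) (j1 j2 : I) :
  j1 != j2 ->
  \prod_j F j = F j1 * (F j2 * \prod_(j | (j != j1) && (j != j2)) F j).
Proof. by move=> ne12; rewrite (bigD1 j1) // (bigD1 j2) // eq_sym. Qed.

(** The identity (a+b)(a+c) = (a+b)a + a(a+c) + (bc - aa) in the columns at j1
    and j2. *)
Lemma fperm_two_columns (R : realType) (I : finType) (K : I -> I -> R)
    (j1 j2 : I) (a b c : I -> R) : j1 != j2 ->
  let upd (x y : I -> R) i j :=
    if j == j1 then x i else if j == j2 then y i else K i j in
  fperm (upd (fun i => a i + b i) (fun i => a i + c i)) =
    fperm (upd (fun i => a i + b i) a) + fperm (upd a (fun i => a i + c i))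
    + (fperm (upd b c) - fperm (upd a a)).
Proof.
move=> ne12 upd.
have expand x y : fperm (upd x y) = \sum_(s : {perm I})
    x (s j1) * y (s j2) * \prod_(j | (j != j1) && (j != j2)) K (s j) j.
  rewrite fperm_col; apply: eq_bigr => s _.
  rewrite (prod_two_factors _ ne12) mulrA /upd !eqxx.
  rewrite eq_sym (negPf ne12); congr (_ * _).
  by apply: eq_bigr => j /andP[/negPf-> /negPf->].
rewrite !expand -sumrB -!big_split /=; apply: eq_bigr => s _; ring.
Qed.

Definition stab (I V : finType) (om : I -> V) : {set {perm I}} :=
  [set s : {perm I} | [forall i, om (s i) == om i]].

Lemma stabP (I V : finType) (om : I -> V) (s : {perm I}) :
  reflect (forall i, om (s i) = om i) (s \in stab om).
Proof. by rewrite inE; apply: (iffP forallP) => H i; apply/eqP. Qed.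

(** A term of the permanent that is not killed assigns to each row i an index
    om (s i) of weight at most that of om i. The total weights agree, so there is
    equality everywhere and s permutes the fibres of om. *)
Lemma fperm_top (R : realType) (I V : finType) (M : I -> V -> R)
    (w : V -> nat) (om : I -> V) :
  injective w -> (forall i v, M i v != 0 -> (w v <= w (om i))%N) ->
  fperm (fun i j => M i (om j)) = (\prod_i M i (om i)) *+ #|stab om|.
Proof.
move=> w_inj top; rewrite -sumr_const.
rewrite /fperm (bigID (mem (stab om))) /= [X in _ + X]big1 ?addr0.
  by apply: eq_bigr => s /stabP om_s; apply: eq_bigr => i _; rewrite om_s.
move=> s Ns; apply/eqP; apply: contraNT Ns => /prodf_neq0 nz; apply/stabP=> i.
apply/w_inj/eqP; rewrite eqn_leq top ?nz //=.
have := eqxx (\sum_i w (om i))%N; rewrite {1}(reindex_perm s) /=.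
rewrite (bigD1 i) //= [X in _ == X](bigD1 i) //= => /eqP eq_sum.
rewrite -(leq_add2r (\sum_(k | k != i) w (om (s k)))) eq_sum leq_add2l.
by apply: leq_sum => k _; rewrite top ?nz.
Qed.

(** Here b and c are chosen once each, so the permutations preserving om fix j1
    and j2 and preserve om'; the transposition of j1 and j2 preserves only om'. *)
Lemma card_stab_lt (I V : finType) (om om' : I -> V) (j1 j2 : I) (a b c : V) :
  j1 != j2 -> b != c ->
  om j1 = b -> om j2 = c -> om' j1 = a -> om' j2 = a ->
  {in ~: [set j1; j2], forall j, om j = om' j /\ om j \notin [set b; c]} ->
  (#|stab om| < #|stab om'|)%N.
Proof.
move=> ne12 bc om1 om2 om'1 om'2 om_out; apply: proper_card.
have fib j : (om j = b -> j = j1) /\ (om j = c -> j = j2).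
  have := om_out j; rewrite !inE; case: (eqVneq j j1) => [->|_].
    by rewrite om1 => _; split=> // eq_bc; rewrite eq_bc eqxx in bc.
  case: (eqVneq j j2) => [->|_].
    by rewrite om2 => _; split=> // eq_cb; rewrite eq_cb eqxx in bc.
  by case=> // _; rewrite negb_or => /andP[/eqP? /eqP?].
apply/properP; split.
  apply/subsetP=> s /stabP om_s; apply/stabP=> j.
  have s1 : s j1 = j1 by apply: (fib _).1; rewrite om_s.
  have s2 : s j2 = j2 by apply: (fib _).2; rewrite om_s.
  case: (boolP (j \in [set j1; j2])) => [|Nj].
    by rewrite !inE => /orP[]/eqP->; rewrite ?s1 ?s2.
  have Nsj : s j \notin [set j1; j2].
    by apply: contra Nj; rewrite !inE -{1}s1 -{1}s2 !(inj_eq perm_inj).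
  have [<- _] := om_out j (etrans (in_setC _ _) Nj).
  by have [<- _] := om_out (s j) (etrans (in_setC _ _) Nsj).
exists (tperm j1 j2); apply/stabP.
  by move=> j; case: tpermP => [->|->|]; rewrite ?om'1 ?om'2.
by move/(_ j1); rewrite tpermL om1 om2 => eq_cb; rewrite eq_cb eqxx in bc.
Qed.

(** Let D be the set of permutations preserving both assignments. A permutation
    preserving om' is in D up to the transposition of j1 and j2, while the
    products of D with the transpositions of j2 with j2, j3, j4 all preserve om
    and are distinct. *)
Lemma card_stab_gt (I V : finType) (om om' : I -> V) (j1 j2 j3 j4 : I)
    (a b c : V) :
  j1 != j2 -> uniq [:: j2; j3; j4] -> b != c ->
  om j1 = b -> om j2 = c -> om j3 = c -> om j4 = c ->
  om' j1 = a -> om' j2 = a ->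
  {in ~: [set j1; j2], forall j, [/\ om j = om' j, om j != b & om' j != a]} ->
  (#|stab om'| < #|stab om|)%N.
Proof.
move=> ne12 uniq234 bc om1 om2 om3 om4 om'1 om'2 om_out.
pose D := stab om :&: stab om'.
have D_gt0 : (0 < #|D|)%N.
  by apply/card_gt0P; exists 1%g; rewrite inE; apply/andP; split;
     apply/stabP=> j; rewrite perm1.
have om'_out j : (j \in ~: [set j1; j2]) = (om' j != a).
  apply/idP/idP => [/om_out[]//|]; apply: contraR.
  by rewrite in_setC negbK in_set2 => /orP[]/eqP->; rewrite ?om'1 ?om'2.
have fix_D s : s \in stab om' -> s j1 = j1 -> s \in D.
  move=> om's s1; rewrite inE om's andbT; apply/stabP=> j.
  have out_s k : (s k \in ~: [set j1; j2]) = (k \in ~: [set j1; j2]).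
    by rewrite !om'_out (stabP _ _ om's).
  have s2 : s j2 = j2.
    have := out_s j2; rewrite !in_setC (set22 j1 j2) /= => /negbFE; rewrite in_set2.
    by rewrite -{1}s1 (inj_eq perm_inj) eq_sym (negPf ne12) => /eqP.
  case: (boolP (j \in ~: [set j1; j2])) => [out_j|]; last first.
    by rewrite in_setC negbK in_set2 => /orP[]/eqP->; rewrite ?s1 ?s2.
  have [-> _ _] := om_out j out_j; rewrite -out_s in out_j.
  by have [-> _ _] := om_out _ out_j; rewrite (stabP _ _ om's).
have D_fix s : s \in D -> s j2 = j2.
  case/setIP=> om_s om's; have s1 : s j1 = j1.
    apply/eqP; apply: contraT => ne_s1; have := stabP _ _ om_s j1; rewrite om1.
    case: (eqVneq (s j1) j2) => [->|ne_s2].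
      by rewrite om2 => cb; rewrite cb eqxx in bc.
    by have [|_ /eqP] := om_out (s j1); rewrite // in_setC in_set2 negb_or ne_s1.
  have := om'_out (s j2); rewrite in_setC (stabP _ _ om's) om'2 eqxx /= => /negbFE.
  by rewrite in_set2 -{1}s1 (inj_eq perm_inj) eq_sym (negPf ne12) => /eqP.
have le2D : (#|stab om'| <= 2 * #|D|)%N.
  have sub : stab om' \subset D :|: [set (s * tperm j1 j2)%g | s in D].
    apply/subsetP=> s om's; apply/setUP.
    have [s1|s1] : s j1 = j1 \/ s j1 = j2.
    - have /(congr1 negb) := om'_out (s j1); rewrite (stabP _ _ om's) om'1 eqxx.
      by rewrite in_setC !negbK in_set2 => /orP[]/eqP->; [left|right].
    - by left; apply: fix_D.
    right; apply/imsetP; exists (s * tperm j1 j2)%g; last first.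
      by rewrite -mulgA tperm2 mulg1.
    apply: fix_D; last by rewrite permM s1 tpermR.
    apply/stabP=> j; rewrite permM -(stabP _ _ om's j).
    by case: tpermP => [->|->|]; rewrite ?om'1 ?om'2.
  apply: leq_trans (subset_leq_card sub) _.
  by rewrite mul2n -addnn (leq_trans (leq_card_setU _ _).1) // leq_add2l leq_imset_card.
have ge3D : (#|D| * 3 <= #|stab om|)%N.
  have <- : #|[set k in [:: j2; j3; j4]]| = 3%N by rewrite cardsE; apply/card_uniqP.
  rewrite -cardsX -(@card_in_imset _ _ (fun u => u.1 * tperm j2 u.2)%g).
    apply: subset_leq_card; apply/subsetP=> _ /imsetP[[s k] /setXP[/= Ds Kk] ->].
    have om_k : om k = c by move: Kk; rewrite !inE => /or3P[]/eqP->.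
    have /setIP[om_s _] := Ds; apply/stabP=> j; rewrite permM -(stabP _ _ om_s j).
    by case: tpermP => [->|->|]; rewrite ?om2 ?om_k.
  move=> [s k] [s' k'] /setXP[/= Ds _] /setXP[/= Ds' _] eq_ss'.
  have eq_k : k = k'.
    have := congr1 (fun t : {perm I} => t j2) eq_ss'.
    by rewrite /= !permM (D_fix s) // (D_fix s') // !tpermL.
  by move: eq_ss'; rewrite eq_k => /mulIg->.
lia.
Qed.

Lemma prodr_bool (R : realType) (I : finType) (b : I -> bool) :
  \prod_i (b i)%:R = [forall i, b i]%:R :> R.
Proof.
have [/forallP b1|/forallPn[i /negPf b0]] := boolP [forall i, b i].
  by rewrite big1 // => i _; rewrite b1.
by rewrite (bigD1 i) //= b0 mul0r.
Qed.

(** Each factor is an affine form in the 0/1 variables t j. In the expansion of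
    the product, a choice of the constant al i or of a column for every row i has
    coefficient 0 unless it uses all the columns, and then it is a permutation. *)
Lemma fperm_alternating_sum (R : realType) (I : finType) (al : I -> R)
    (X : I -> I -> R) :
  \sum_(t : {ffun I -> bool}) (\prod_j (if t j then 1 else -1)) *
     \prod_i (al i + \sum_(j | t j) X i j) = fperm X.
Proof.
pose Y i (o : option I) := if o is Some j then X i j else al i.
pose ok (t : {ffun I -> bool}) (o : option I) := if o is Some j then t j else true.
have row (t : {ffun I -> bool}) i :
    al i + \sum_(j | t j) X i j = \sum_o Y i o * (ok t o)%:R.
  rewrite (bigD1 None) //= mulr1; congr (_ + _).
  rewrite (reindex_onto Some (fun o => odflt i o)) /=; last by case.
  rewrite big_mkcond /=; apply: eq_big => [j|j _]; first by rewrite ?eqxx.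
  by case: (t j); rewrite ?mulr1 ?mulr0.
under eq_bigr => t _.
  under [X in _ * X]eq_bigr => i _ do rewrite row.
  rewrite bigA_distr_bigA big_distrr /=.
  over.
rewrite exchange_big /=.
(* Summing over t the terms that choose g leaves the g that use every column. *)
pose full (g : {ffun I -> option I}) := [forall j, exists i, g i == Some j].
have collapse (g : {ffun I -> option I}) :
    \sum_(t : {ffun I -> bool}) (\prod_j (if t j then 1 else -1)) *
      \prod_i (Y i (g i) * (ok t (g i))%:R) = \prod_i Y i (g i) * (full g)%:R.
  under [LHS]eq_bigr => t _ do rewrite big_split /= mulrCA.
  rewrite -big_distrr /=; congr (_ * _).
  pose used j := [exists i, g i == Some j].
  pose F j (b : bool) : R := (if b then 1 else -1) * (used j ==> b)%:R.
  transitivity (\sum_(t : {ffun I -> bool}) \prod_j F j (t j)).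
    apply: eq_bigr => t _; rewrite big_split /=; congr (_ * _).
    rewrite !prodr_bool; congr (_%:R); congr nat_of_bool.
    apply/forallP/forallP => [okt j|okt i].
      apply/implyP=> /existsP[i /eqP gi]; by have := okt i; rewrite gi.
    case gi: (g i) => [j|] //; apply: (implyP (okt j)).
    by apply/existsP; exists i; rewrite gi.
  rewrite -bigA_distr_bigA /=.
  rewrite /full -prodr_bool; apply: eq_bigr => j _.
  by rewrite -/(used j) big_bool /F implybT implybF; case: (used j) => /=; ring.
rewrite (eq_bigr _ (fun g _ => collapse g)).
rewrite (bigID full) /= [X in _ + X]big1 ?addr0; last first.
  by move=> g /negPf->; rewrite mulr0.
pose lift (s : {perm I}) : {ffun I -> option I} := [ffun i => Some (s i)].
have lift_inj : injective lift.
  move=> s s' /ffunP eq_ss'; apply/permP=> i.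
  by have := eq_ss' i; rewrite !ffunE => -[].
have full_lift s : full (lift s).
  by apply/forallP=> j; apply/existsP; exists ((s^-1)%g j); rewrite ffunE permKV.
have liftP g : full g -> exists s, g = lift s.
  move=> /forallP/(_ _)/existsP full_g.
  have [k kP] := fin_all_exists full_g.
  have k_inj : injective k.
    by move=> j j' eq_k; have := kP j; rewrite eq_k (eqP (kP j')) => /eqP[].
  exists (perm k_inj)^-1%g; apply/ffunP=> i; rewrite ffunE -(eqP (kP _)).
  by rewrite -[k _](permE k_inj) permKV.
rewrite (reindex_onto lift (fun g => odflt 1%g [pick s | lift s == g])) /=.
  apply: eq_big => [s|s _].
    by rewrite full_lift; case: pickP => [s' /eqP/lift_inj->|/(_ s)] /=; rewrite eqxx.
  by rewrite full_lift mulr1; apply: eq_bigr => i _; rewrite ffunE.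
move=> g /liftP[s ->]; case: pickP => [s' /eqP//|/(_ s)]; by rewrite eqxx.
Qed.

Lemma sum_pred1 (R : realType) (Y : finType) (x : Y) (F : Y -> R) :
  \sum_y (y == x)%:R * F y = F x.
Proof.
by rewrite (bigD1 x) //= eqxx mul1r big1 ?addr0 // => y /negPf->; rewrite mul0r.
Qed.

(** For j other than j1 and j2, the columns A (inr j) and A (inl (phi j)) span
    A (inl (om j)), so the nonzero permanent expands into columns of A. These are
    distinct since phi is injective and avoids a. *)
Lemma span_injection (R : realType) (V I : finType) (A : I -> V + I -> R)
    (a : V) (j1 j2 : I) (phi om : I -> V) (x y : V + I) :
  j1 != j2 ->
  {in ~: [set j1; j2], forall j, phi j != a} ->
  {in ~: [set j1; j2] &, injective phi} ->
  {in ~: [set j1; j2], forall j, om j != phi j ->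
    forall i, A i (inr j) = A i (inl (om j)) + A i (inl (phi j))} ->
  x != y -> x \in [:: inl a; inr j1; inr j2] -> y \in [:: inl a; inr j1; inr j2] ->
  fperm (fun i j => if j == j1 then A i x else if j == j2 then A i y
    else A i (inl (om j))) != 0 ->
  exists h : I -> V + I, injective h /\ fperm (fun i j => A i (h j)) != 0.
Proof.
move=> ne12 phi_a phi_inj spanA ne_xy Hx Hy.
pose cf (j : I) (z : V + I) : R :=
  if j == j1 then (z == x)%:R else if j == j2 then (z == y)%:R
  else if om j == phi j then (z == inl (phi j))%:R
  else (z == inr j)%:R - (z == inl (phi j))%:R.
have outE j : (j \in ~: [set j1; j2]) = (j != j1) && (j != j2).
  by rewrite in_setC in_set2 negb_or.
rewrite (@eq_fperm _ _ _ (fun i j => \sum_z cf j z * A i z)); last first.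
  move=> i j; rewrite /cf; case: eqVneq => [_|ne1]; first by rewrite sum_pred1.
  case: eqVneq => [_|ne2]; first by rewrite sum_pred1.
  case: eqVneq => [->|ne]; first by rewrite sum_pred1.
  under eq_bigr => z _ do rewrite mulrBl.
  by rewrite sumrB !sum_pred1 spanA ?addrK // outE ne1.
move/fperm_span=> [h [hP nz]]; exists h; split=> //.
have h1 : h j1 = x.
  by have := hP j1; rewrite /cf eqxx; case: (h j1 =P x); rewrite ?eqxx.
have h2 : h j2 = y.
  have := hP j2; rewrite /cf (eq_sym j2) (negPf ne12) eqxx.
  by case: (h j2 =P y); rewrite ?eqxx.
have hF j : j != j1 -> j != j2 -> h j = inl (phi j) \/ h j = inr j.
  move=> ne1 ne2; have := hP j; rewrite /cf (negPf ne1) (negPf ne2).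
  case: (h j =P inl (phi j)) => [->|_]; first by left.
  by case: (h j =P inr j) => [->|_]; [right|case: ifP; rewrite ?subrr eqxx].
have hN j z : z \in [:: inl a; inr j1; inr j2] -> j != j1 -> j != j2 -> h j != z.
  move=> Hz ne1 ne2; have ne_a : phi j != a by rewrite phi_a // outE ne1.
  by case: (hF j ne1 ne2) => ->; move: Hz; rewrite !inE => /or3P[]/eqP->.
move=> j j'; case: (eqVneq j j1) => [->|nj1]; [|case: (eqVneq j j2) => [->|nj2]];
  (case: (eqVneq j' j1) => [->|nj1']; [|case: (eqVneq j' j2) => [->|nj2']]) => //.
- by rewrite h1 h2 => eq_xy; rewrite eq_xy eqxx in ne_xy.
- by rewrite h1 => /esym/eqP; rewrite (negPf (hN j' x _ _ _)).
- by rewrite h1 h2 => eq_xy; rewrite eq_xy eqxx in ne_xy.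
- by rewrite h2 => /esym/eqP; rewrite (negPf (hN j' y _ _ _)).
- by rewrite h1 => /eqP; rewrite (negPf (hN j x _ _ _)).
- by rewrite h2 => /eqP; rewrite (negPf (hN j y _ _ _)).
case: (hF j nj1 nj2) => ->; case: (hF j' nj1' nj2') => -> // [//].
by apply: phi_inj; rewrite outE ?nj1 ?nj1'.
Qed.

Lemma permanent_fperm (R : realType) (I : finType) (X : I -> I -> R) :
  permanent (\matrix_(i < #|I|, j < #|I|) X (enum_val i) (enum_val j)) = fperm X.
Proof.
have to_inj (s : 'S_#|I|) : injective (fun x : I => enum_val (s (enum_rank x))).
  by move=> x y /enum_val_inj/perm_inj/enum_rank_inj.
have of_inj (t : {perm I}) : injective (fun i : 'I_#|I| => enum_rank (t (enum_val i))).
  by move=> i j /enum_rank_inj/perm_inj/enum_val_inj.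
rewrite /fperm (reindex (fun s => perm (to_inj s))) /=; last first.
  exists (fun t => perm (of_inj t)) => s _; apply/permP=> x; rewrite !permE.
    by rewrite !enum_valK.
  by rewrite !enum_rankK.
apply: eq_bigr => s _; rewrite (reindex _ (onW_bij _ (enum_rank_bij I))) /=.
by apply: eq_bigr => x _; rewrite mxE permE enum_rankK.
Qed.

(** * The matrix of a graph *)

Lemma orientation_exists (G : sgraph) : inhabited (orientation G).
Proof.
have ends (e : edge G) : exists p : G * G, val e == [set p.1; p.2].
  by have [u [v [_ _ ->]]] := edge_endsP e; exists (u, v) => /=.
have [p pP] := fin_all_exists ends.
by constructor; apply: (@Orientation G (fun e => (p e).1) (fun e => (p e).2)) => e;
   apply/eqP.
Qed.

Lemma head_neq_tail (G : sgraph) (o : orientation G) (e : edge G) :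
  head o e != tail o e.
Proof.
by have := card_edge e; rewrite (orientationP o) cards2 eq_sym; case: eqP.
Qed.

Lemma AG_vertex (R : realType) (G : sgraph) (o : orientation G) (e : edge G)
    (v : G) :
  AG_entry R o e (inl v) = (v == head o e)%:R - (v == tail o e)%:R.
Proof.
rewrite /=; case: eqP => [->|_]; last by rewrite sub0r; case: eqP; rewrite ?oppr0.
by rewrite (negPf (head_neq_tail o e)) subr0.
Qed.

(** For e' = e both terms are 1, which matches the zero entry of A_G. *)
Lemma AG_edge (R : realType) (G : sgraph) (o : orientation G) (e e' : edge G) :
  AG_entry R o e (inr e') =
    (head o e \in val e')%:R - (tail o e \in val e')%:R.
Proof.
rewrite /=; case: (eqVneq e' e) => [->|ne].
  by rewrite (orientationP o e) !inE !eqxx orbT subrr.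
case h: (head o e \in val e'); case t: (tail o e \in val e');
  rewrite ?subr0 ?sub0r ?oppr0 //.
case/eqP: ne; apply/val_inj/esym/eqP; rewrite eqEcard !card_edge leqnn andbT.
by rewrite (orientationP o) subUset !sub1set t h.
Qed.

Lemma AG_edge_split (R : realType) (G : sgraph) (o : orientation G)
    (e e' : edge G) (u v : G) : val e' = [set u; v] ->
  AG_entry R o e (inr e') = AG_entry R o e (inl u) + AG_entry R o e (inl v).
Proof.
move=> ve'; rewrite AG_edge !AG_vertex ve' !inE !(eq_sym u) !(eq_sym v).
have ne_uv : u != v by have := card_edge e'; rewrite ve' cards2; case: eqP.
have orD x : ((x == u) || (x == v))%:R = (x == u)%:R + (x == v)%:R :> R.
  by case: (eqVneq x u) => [->|]; rewrite ?(negPf ne_uv) ?addr0 ?add0r.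
by rewrite !orD; ring.
Qed.

(** Row e of A_G computes the difference of the vertex sums at the ends of e. *)
Lemma weight_sum_diff (R : realType) (G : sgraph) (o : orientation G)
    (f : G + edge G -> R) (e : edge G) :
  weight_sum f (head o e) - weight_sum f (tail o e) =
    \sum_y AG_entry R o e y * f y.
Proof.
rewrite big_sumType /weight_sum opprD addrACA; congr (_ + _).
  under eq_bigr => v _ do rewrite AG_vertex mulrBl.
  by rewrite sumrB !(sum_pred1 _ (fun v => f (inl v))).
rewrite [X in X - _]big_mkcond [X in _ - X]big_mkcond -sumrB; apply: eq_bigr => e' _.
by rewrite AG_edge mulrBl; do 2!case: ifP => _; rewrite ?mul1r ?mul0r.
Qed.

Lemma AG_vertex_neq0 (R : realType) (G : sgraph) (o : orientation G)
    (e : edge G) (v : G) : (AG_entry R o e (inl v) != 0) = (v \in val e).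
Proof.
rewrite AG_vertex (orientationP o) !inE; have := head_neq_tail o e.
case: (eqVneq v (head o e)) => [->|_] ne.
  by rewrite (negPf ne) subr0 oner_eq0 orbT.
by rewrite orbF sub0r oppr_eq0; case: (v == _); rewrite ?oner_eq0 ?eqxx.
Qed.

Lemma AG_opposite (R : realType) (G : sgraph) (o : orientation G)
    (e : edge G) (u v : G) : val e = [set u; v] ->
  AG_entry R o e (inl v) = - AG_entry R o e (inl u).
Proof.
move=> ve; apply/eqP; rewrite -addr_eq0 addrC -(AG_edge_split R o e ve) AG_edge.
by rewrite (orientationP o) !inE !eqxx orbT subrr.
Qed.

(** * Consequences of distinct columns with nonzero permanent *)

Lemma pind_le1_of_injection (R : realType) (G : sgraph) (o : orientation G)
    (h : edge G -> G + edge G) : injective h ->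
  fperm (fun i j => AG_entry R o i (h j)) != 0 -> pind_le (AG R o) 1.
Proof.
move=> h_inj nz; exists (fun j => enum_rank (h (enum_val j))); split.
  rewrite -permanent_fperm in nz; congr (_ != 0): nz; apply: eq_bigr => s _.
  by apply: eq_bigr => i _; rewrite !mxE enum_rankK.
move=> y; apply/card_le1_eqP=> i j; rewrite !inE => /eqP hi /eqP hj.
by apply/enum_val_inj/h_inj/enum_rank_inj; rewrite hi hj.
Qed.

(** The weights outside the range of h keep their first value; if no choice of the
    others were proper, every summand of [fperm_alternating_sum] would vanish. *)
Lemma choosable_of_injection (R : realType) (G : sgraph) (o : orientation G)
    (h : edge G -> G + edge G) : injective h ->
  fperm (fun i j => AG_entry R o i (h j)) != 0 -> choosable R G 2 2.
Proof.
move=> h_inj nz L LV LE.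
have L2 z : exists p : R * R, [&& p.1 \in L z, p.2 \in L z & p.1 != p.2].
  have cardL : #|` L z| = 2%N by case: z => [v|e]; rewrite ?LV ?LE.
  have /fset0Pn[x Lx] : L z != fset0 by rewrite -cardfs_gt0 cardL.
  have /fset0Pn[y] : (L z `\ x)%fset != fset0.
    by rewrite -cardfs_gt0; have := cardfsD1 x (L z); rewrite cardL Lx; lia.
  by rewrite !inE => /andP[ne_yx Ly]; exists (x, y); rewrite /= Lx Ly eq_sym.
have {L2} [p pP] := fin_all_exists L2.
(* As h is injective, at most one summand is nonzero, so the weight of z is one of
   the two chosen elements of L z. *)
pose f (t : {ffun edge G -> bool}) z : R :=
  (p z).1 + \sum_(j | t j) (h j == z)%:R * ((p z).2 - (p z).1).
have fL t z : f t z \in L z.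
  have /and3P[L1 L2 _] := pP z; rewrite /f.
  have [/existsP[j /andP[tj /eqP hj]]|none] := boolP [exists j, t j && (h j == z)].
    rewrite (bigD1 j) //= hj eqxx mul1r big1 ?addr0 ?[_ + (_ - _)]addrC ?subrK //.
    move=> k /andP[_ ne]; rewrite -hj (inj_eq h_inj) (negPf ne) mul0r //.
  rewrite big1 ?addr0 // => j tj; move/existsPn/(_ j): none.
  by rewrite tj /= => /negPf->; rewrite mul0r.
pose X i j := AG_entry R o i (h j) * ((p (h j)).2 - (p (h j)).1).
have diff t e : weight_sum (f t) (head o e) - weight_sum (f t) (tail o e) =
    \sum_y AG_entry R o e y * (p y).1 + \sum_(j | t j) X e j.
  rewrite weight_sum_diff.
  under eq_bigr => y _ do rewrite /f mulrDr big_distrr /=.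
  rewrite big_split /=; congr (_ + _); rewrite exchange_big /=.
  apply: eq_bigr => j _; rewrite (bigD1 (h j)) //= eqxx mul1r big1 ?addr0 //.
  by move=> y ne; rewrite eq_sym (negPf ne) mul0r mulr0.
have nzX : fperm X != 0.
  have -> : fperm X = fperm (fun i j => AG_entry R o i (h j)) *
      \prod_j ((p (h j)).2 - (p (h j)).1).
    rewrite !fperm_col big_distrl /=; apply: eq_bigr => s _.
    by rewrite -big_split.
  rewrite mulf_neq0 //; apply/prodf_neq0 => j _.
  by have /and3P[_ _ ne] := pP (h j); rewrite subr_eq0 eq_sym.
have [/existsP[t /forallP tP]|none] := boolP [exists t : {ffun edge G -> bool},
    [forall e, weight_sum (f t) (head o e) - weight_sum (f t) (tail o e) != 0]].
  exists (f t); split=> // u v uv eq_uv; have [e ve] := adj_edge uv.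
  have := tP e; rewrite subr_eq0 => /eqP; apply; move: ve (head_neq_tail o e).
  rewrite (orientationP o) => eq_ends.
  have := set21 (tail o e) (head o e); have := set22 (tail o e) (head o e).
  rewrite eq_ends !inE => /orP[]/eqP-> /orP[]/eqP->; rewrite ?eqxx // eq_uv //.
case/eqP: nzX; rewrite -(fperm_alternating_sum
  (fun e => \sum_y AG_entry R o e y * (p y).1)) big1 // => t _.
move/existsPn/(_ t)/forallPn: none => [e]; rewrite negbK diff => /eqP e0.
by rewrite [X in _ * X](bigD1 e) //= e0 mul0r mulr0.
Qed.

(** * Distinct columns for bicyclic graphs *)

Definition top_end (G : sgraph) (o : orientation G) (w : G -> nat) (e : edge G) : G :=
  if (w (head o e) < w (tail o e))%N then tail o e else head o e.

Lemma top_end_in (G : sgraph) (o : orientation G) (w : G -> nat) (e : edge G) :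
  top_end o w e \in val e.
Proof. by rewrite (orientationP o) /top_end; case: ifP; rewrite !inE eqxx ?orbT. Qed.

Lemma top_end_max (G : sgraph) (o : orientation G) (w : G -> nat) (e : edge G) v :
  v \in val e -> (w v <= w (top_end o w e))%N.
Proof.
by rewrite (orientationP o) /top_end !inE => /orP[]/eqP->; case: ltnP => // /ltnW.
Qed.

Lemma top_endE (G : sgraph) (o : orientation G) (w : G -> nat) (e : edge G) (u v : G) :
  val e = [set u; v] -> (w u < w v)%N -> top_end o w e = v.
Proof.
move=> ve lt_uv; have := top_end_in o w e; have := @top_end_max _ o w e v.
rewrite ve !inE eqxx orbT => /(_ isT) le_v /orP[]/eqP // eq_u.
by rewrite eq_u leqNgt lt_uv in le_v.
Qed.

(** An order of the vertices in which the places of a and c can be chosen. The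
    ranks in C are shifted to leave room below for pa = 0 and pc = 2; the gap
    between C and its complement leaves room for pa = |G| + 4 and pc = |G| + 3. *)
Definition core_weight (G : sgraph) (C : {set G}) (a b c : G) (pa pc : nat)
    (v : G) : nat :=
  (if v == a then pa else if v == b then 1 else if v == c then pc
  else if v \in C then 3 + enum_rank v else #|G| * 2 + 9 + enum_rank v)%N.

Lemma core_weight_inj (G : sgraph) (C : {set G}) (a b c : G) (pa pc : nat) :
  pa \in [:: 0; #|G| + 4]%N -> pc \in [:: 2; #|G| + 3]%N ->
  injective (core_weight C a b c pa pc).
Proof.
rewrite !inE => pa_vals pc_vals u v; rewrite /core_weight.
have rank_lt (x : G) : (enum_rank x < #|G|)%N by apply: ltn_ord.
have := rank_lt u; have := rank_lt v.
have : enum_rank u = enum_rank v :> nat -> u = v by move/ord_inj/enum_rank_inj.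
move: (nat_of_ord (enum_rank u)) (nat_of_ord (enum_rank v)).
move=> ru rv rank_inj lt_v lt_u {rank_lt}.
case: (u =P a) => [ua|_]; case: (v =P a) => [va|_];
  try by [rewrite ua va | move: pa_vals pc_vals; do !case: ifP => _;
         clear -lt_u lt_v; lia].
case: (u =P b) => [ub|_]; case: (v =P b) => [vb|_];
  try by [rewrite ub vb | move: pa_vals pc_vals; do !case: ifP => _;
         clear -lt_u lt_v; lia].
case: (u =P c) => [uc|_]; case: (v =P c) => [vc|_];
  try by [rewrite uc vc | move: pa_vals pc_vals; do !case: ifP => _;
         clear -lt_u lt_v; lia].
by move=> eq_w; apply: rank_inj; move: eq_w; do !case: ifP => _; clear -lt_u lt_v; lia.
Qed.

(** The larger-endpoint assignments [om], with a lowest, and [om'], with a on top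
    of C, differ only at e1 and e2: at b and c against a twice. *)
Lemma bicyclic_injection (R : realType) (G : sgraph) (o : orientation G) :
  bicyclic G ->
  exists h : edge G -> G + edge G, injective h /\
    fperm (fun i j => AG_entry R o i (h j)) != 0.
Proof.
move=> bG; have [C [a [b [c [e1 [e2 [phi K]]]]]]] := bicyclic_pivot bG.
have ab := pivot_ab K; have ac := pivot_ac K; have bc := pivot_bc K.
have ve1 := pivot_e1 K; have ve2 := pivot_e2 K.
have Ca := pivot_a_in K; have Cb := pivot_b_in K; have Cc := pivot_c_in K.
have ne12 : e1 != e2.
  apply: contraNneq bc => eq12; move: ve2.
  rewrite -eq12 ve1 => /setP/(_ b); rewrite !inE eqxx orbT.
  by rewrite eq_sym (negPf ab) => /esym.
(* The two positions of c handle the two cases of b and c adjacent or not. *)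
pose triangle := [exists e3 : edge G, val e3 == [set b; c]].
pose pc := (if triangle then #|G| + 3 else 2)%N.
have pc_vals : pc \in [:: 2; #|G| + 3]%N.
  by rewrite /pc !inE; case: ifP; rewrite eqxx ?orbT.
pose w := core_weight C a b c 0 pc; pose w' := core_weight C a b c (#|G| + 4) pc.
have w_inj : injective w by apply: core_weight_inj; rewrite // !inE eqxx.
have w'_inj : injective w' by apply: core_weight_inj; rewrite // !inE eqxx orbT.
have rank_lt (v : G) : (enum_rank v < #|G|)%N by apply: ltn_ord.
have pc_le : (2 <= pc <= #|G| + 3)%N by move: pc_vals; clear; rewrite !inE; lia.
have wa : w a = 0%N by rewrite /w /core_weight eqxx.
have w'a : w' a = (#|G| + 4)%N by rewrite /w' /core_weight eqxx.
have ww' v : v != a -> w' v = w v by rewrite /w' /w /core_weight => /negPf->.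
have wb : w b = 1%N by rewrite /w /core_weight eq_sym (negPf ab) eqxx.
have wc : w c = pc by rewrite /w /core_weight !(eq_sym c) (negPf ac) (negPf bc) eqxx.
have w_out v : v \notin C -> (#|G| + 4 < w v)%N.
  move=> NCv; have NC x : x \in C -> v == x = false.
    by move=> Cx; apply: contraNF NCv => /eqP->.
  by rewrite /w /core_weight !NC // (negPf NCv); clear; lia.
have w_in v : v \in C -> v \notin [set a; b; c] -> (2 < w v < #|G| + 3)%N.
  rewrite !inE !negb_or -andbA => Cv /and3P[/negPf va /negPf vb /negPf vc].
  by rewrite /w /core_weight va vb vc Cv; have := rank_lt v; clear; lia.
pose om := top_end o w; pose om' := top_end o w'.
have om1 : om e1 = b by apply: (top_endE _ ve1); rewrite wa wb.
have om2 : om e2 = c.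
  by apply: (top_endE _ ve2); rewrite wa wc; case/andP: pc_le => /ltnW.
have om'1 : om' e1 = a.
  apply: (@top_endE _ _ _ _ b); first by rewrite setUC.
  by rewrite ww' 1?eq_sym // w'a wb addnC.
have om'2 : om' e2 = a.
  apply: (@top_endE _ _ _ _ c); first by rewrite setUC.
  by rewrite ww' 1?eq_sym // w'a wc; move: pc_le; clear; lia.
have w_ge2 v : v != a -> v != b -> (1 < w v)%N.
  move=> va vb; rewrite /w /core_weight (negPf va) (negPf vb).
  by move: pc_le; clear; do !case: ifP => _; lia.
have om_in e : om e \in val e by apply: top_end_in.
have om_out e : e \in ~: [set e1; e2] -> om e = om' e /\ om e \notin [set a; b].
  rewrite in_setC in_set2 => e12; case: (boolP (a \in val e)) => ea.
    have [z za ve] := edge_other_end ea.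
    have NCz : z \notin C.
      apply: contra e12 => Cz; apply: (pivot_star K) => //.
      by rewrite ve subUset !sub1set Ca Cz.
    have lt_z := w_out z NCz.
    have -> : om e = z by apply: (top_endE _ ve); rewrite wa; move: lt_z; clear; lia.
    have -> : om' e = z by apply: (top_endE _ ve); rewrite w'a ww'.
    split=> //; rewrite in_set2 (negPf za) /=.
    by apply: contraNneq NCz => ->.
  have ne_end v : v \in val e -> v != a by apply: contraTneq => ->.
  split.
    by rewrite /om /om' /top_end !ww' ?ne_end // (orientationP o) ?set21 ?set22.
  rewrite in_set2 (negPf (ne_end _ (om_in e))) /=.
  apply/eqP=> om_b; have eb : b \in val e by rewrite -om_b.
  have [z zb ve] := edge_other_end eb.
  have ez : z \in val e by rewrite ve set22.
  have := top_end_max o w ez; rewrite -/(om e) om_b wb leqNgt.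
  by rewrite w_ge2 // ne_end.
pose A := AG_entry R o.
pose P := \prod_e A e (inl (om e)).
have opp1 : A e1 (inl b) = - A e1 (inl a) := AG_opposite R o ve1.
have opp2 : A e2 (inl c) = - A e2 (inl a) := AG_opposite R o ve2.
(* Both signs at e1 and e2 change, so the product does not. *)
have P'E : \prod_e A e (inl (om' e)) = P.
  rewrite /P !(prod_two_factors _ ne12).
  rewrite om1 om2 om'1 om'2 opp1 opp2 mulNr [in RHS]mulNr mulrN opprK.
  congr (_ * (_ * _)); apply: eq_bigr => e /andP[e_1 e_2].
  by have [|<- _] := om_out e; rewrite // in_setC in_set2 negb_or e_1.
have P_nz : P != 0.
  by apply/prodf_neq0 => e _; rewrite /A AG_vertex_neq0 top_end_in.
have stab_ne : #|stab om| != #|stab om'|.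
  rewrite neq_ltn; apply/orP; case: (boolP triangle) => [tri|no_tri]; [right|left].
    have wcN : w c = (#|G| + 3)%N by rewrite wc /pc tri.
    have /existsP[e3 /eqP ve3] := tri.
    have [d [e4 [Cd d_new ve4]]] := pivot_triangle K ve3.
    have /andP[_ wd] := w_in d Cd d_new.
    have om3 : om e3 = c by apply: (top_endE _ ve3); rewrite wb wcN addnC.
    have om4 : om e4 = c by apply: (@top_endE _ _ _ _ d); rewrite ?wcN // setUC.
    move: d_new; rewrite !inE !negb_or -andbA => /and3P[da db _].
    have a3 : a \notin val e3 by rewrite ve3 in_set2 negb_or ab.
    have a4 : a \notin val e4 by rewrite ve4 in_set2 negb_or ac eq_sym.
    have b4 : b \notin val e4 by rewrite ve4 in_set2 negb_or bc eq_sym.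
    apply: (@card_stab_gt _ _ om om' e1 e2 e3 e4 a b c) => // [|e eN].
      rewrite /= !inE negb_or !andbT; apply/andP; split; [apply/andP; split|].
      - by apply: contraNneq a3 => <-; rewrite ve2 set21.
      - by apply: contraNneq a4 => <-; rewrite ve2 set21.
      - by apply: contraNneq b4 => <-; rewrite ve3 set21.
    have [<-] := om_out e eN; rewrite in_set2 negb_or => /andP[? ?]; by split.
  have wc2 : w c = 2%N by rewrite wc /pc (negPf no_tri).
  apply: (@card_stab_lt _ _ om om' e1 e2 a b c) => // e eN.
  have [<-] := om_out e eN; rewrite !in_set2 !negb_or => /andP[om_a om_b]; split=> //.
  rewrite om_b; apply/eqP=> om_c; have ec : c \in val e by rewrite -om_c.
  have [z zc ve] := edge_other_end ec.
  have ez : z \in val e by rewrite ve set22.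
  have := top_end_max o w ez; rewrite -/(om e) om_c wc2 => wz.
  case: (eqVneq z a) => [za|za].
    have ee2 : e = e2 by apply/val_inj; rewrite ve za setUC ve2.
    by move: eN; rewrite ee2 in_setC set22.
  case: (eqVneq z b) => [zb|zb].
    by case/existsP: no_tri; exists e; rewrite ve zb setUC.
  have /w_inj zc' : w z = w c by apply/eqP; rewrite wc2 eqn_leq wz w_ge2.
  by rewrite zc' eqxx in zc.
pose upd x y i j := if j == e1 then A i x else if j == e2 then A i y
  else A i (inl (om j)).
have diff_nz : fperm (upd (inl b) (inl c)) - fperm (upd (inl a) (inl a)) != 0.
  have -> : fperm (upd (inl b) (inl c)) = P *+ #|stab om|.
    rewrite -(@fperm_top _ _ _ (fun e v => A e (inl v)) w) => // [|e v].
      apply: eq_fperm => i j; rewrite /upd.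
      case: eqVneq => [->|_]; first by rewrite om1.
      by case: eqVneq => [->|]; rewrite ?om2.
    by rewrite /A AG_vertex_neq0; apply: top_end_max.
  have -> : fperm (upd (inl a) (inl a)) = P *+ #|stab om'|.
    rewrite -P'E -(@fperm_top _ _ _ (fun e v => A e (inl v)) w') => // [|e v].
      apply: eq_fperm => i j; rewrite /upd.
      case: eqVneq => [->|e_1]; first by rewrite om'1.
      case: eqVneq => [->|e_2]; first by rewrite om'2.
      by have [|<- _] := om_out j; rewrite // in_setC in_set2 negb_or e_1.
    by rewrite /A AG_vertex_neq0; apply: top_end_max.
  rewrite subr_eq0 -[P *+ _]mulr_natr -[P *+ #|stab om'|]mulr_natr.
  by rewrite (inj_eq (mulfI P_nz)) eqr_nat.
have col1 i : A i (inr e1) = A i (inl a) + A i (inl b) := AG_edge_split R o i ve1.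
have col2 i : A i (inr e2) = A i (inl a) + A i (inl c) := AG_edge_split R o i ve2.
have two_columns : fperm (upd (inr e1) (inr e2)) =
    fperm (upd (inr e1) (inl a)) + fperm (upd (inl a) (inr e2))
    + (fperm (upd (inl b) (inl c)) - fperm (upd (inl a) (inl a))).
  have := fperm_two_columns (fun i j => A i (inl (om j))) (fun i => A i (inl a))
    (fun i => A i (inl b)) (fun i => A i (inl c)) ne12.
  move=> /= two; etransitivity; [|etransitivity; [exact: two|]].
    by apply: eq_fperm => i j; rewrite /upd col1 col2.
  by congr (_ + _ + _); apply: eq_fperm => i j; rewrite /upd ?col1 ?col2.
have conclude x y : x != y -> x \in [:: inl a; inr e1; inr e2] ->
    y \in [:: inl a; inr e1; inr e2] -> fperm (upd x y) != 0 ->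
    exists h : edge G -> G + edge G, injective h /\ fperm (fun i j => A i (h j)) != 0.
  move=> xy Hx Hy; apply: (span_injection ne12 _ (pivot_phi_inj K) _ xy Hx Hy) => e eN.
    by have := pivot_phi_end K eN; rewrite in_setD1 => /andP[].
  move=> ne i; apply: AG_edge_split; apply/esym/eqP.
  have := pivot_phi_end K eN; rewrite in_setD1 => /andP[_ phi_e].
  by rewrite eqEcard card_edge cards2 ne subUset !sub1set om_in phi_e.
have [nz|z12] := boolP (fperm (upd (inr e1) (inr e2)) != 0).
  by apply: conclude nz; rewrite ?inE ?eqxx ?orbT.
have [nz|z1a] := boolP (fperm (upd (inr e1) (inl a)) != 0).
  by apply: conclude nz; rewrite ?inE ?eqxx ?orbT.
have [nz|za2] := boolP (fperm (upd (inl a) (inr e2)) != 0).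
  by apply: conclude nz; rewrite ?inE ?eqxx ?orbT.
move: two_columns diff_nz.
rewrite (eqP (negbNE z12)) (eqP (negbNE z1a)) (eqP (negbNE za2)).
by rewrite !add0r => <-; rewrite eqxx.
Qed.

Theorem theorem3p10 (R : realType) (B : sgraph) (n : nat)
    (cardB : #|B| = n) (bicB : bicyclic B) :
  (forall o : orientation B, is_pind (AG R o) 1) /\ choosable R B 2 2.
Proof.
split=> [o|].
  have [h [h_inj h_nz]] := bicyclic_injection R o bicB.
  split; first exact: pind_le1_of_injection h_inj h_nz.
  move=> k [g [_ g_le]]; have m_gt0 : (0 < #|edge B|)%N by case: bicB => _ ->.
  apply: leq_trans (g_le (g (Ordinal m_gt0))).
  by apply/card_gt0P; exists (Ordinal m_gt0); rewrite inE.
have [o] := orientation_exists B.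
have [h [h_inj h_nz]] := bicyclic_injection R o bicB.
exact: choosable_of_injection h_inj h_nz.
Qed.
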